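(* For all $r, n \in \mathbb{N}$, \[ 4U_{r+2}(n) = n^2U_r(n) - 4n(n-1)U_r(n-2), \] and $U_r(n)$ may be computed from this recurrence using the initial conditions \[ U_0(n) = 2^n,\qquad U_1(2n) = n\binom{2n}{n},\qquad U_1(2n+1) = (2n+1)\binom{2n}{n} \quad\text{for all } n \in \mathbb{N}. \]
   Context: $\mathbb{N}$ denotes the non-negative integers. For $r\in\mathbb{N}$ and $n\in\mathbb{Z}$ define \[ U_r(n) = \sum_{k\in\mathbb{Z}} \binom{n}{k}\left|\frac{n}{2}-k\right|^r, \] where $0^0$ is interpreted as $1$, and for $n\in\mathbb{N}$ the binomial coefficient $\binom{n}{k}$ is $0$ if $k<0$ or $k>n$ and $\frac{n!}{(n-k)!\,k!}$ otherwise. By convention $U_r(n)=0$ for $n<0$. *)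

(* Defs.v *)
From mathcomp Require Export all_boot all_order all_algebra.
From mathcomp Require Export classical_sets fsbigop.

Set Implicit Arguments.
Unset Strict Implicit.
Unset Printing Implicit Defensive.
Import GRing.Theory Num.Theory.
Local Open Scope ring_scope.

Definition binz (n : nat) (k : int) : nat :=
  if k is Posz j then 'C(n, j) else 0%N.

(* The sum over all integers is the finite-support sum of fsbigop; its summand
   vanishes outside 0 <= k <= n. The convention 0^0 = 1 is that of [^+]. *)
Definition U (r : nat) (n : int) : rat :=
  if n is Posz m then
    \sum_(k \in [set: int]%classic)
      (binz m k)%:R * `|m%:R / 2%:R - k%:~R : rat| ^+ r
  else 0.

(* Only arguments n in N are constrained: for n = 0, 1 the value V r (n - 2)
   occurs with coefficient 0. *)
Definition recurrence (V : nat -> int -> rat) : Prop :=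
  forall r n : nat,
    4%:R * V r.+2 n%:Z =
      n%:R ^+ 2 * V r n%:Z - 4%:R * n%:R * (n%:R - 1) * V r (n%:Z - 2%:Z).

Definition initial_conditions (V : nat -> int -> rat) : Prop :=
  forall n : nat,
    [/\ V 0%N n%:Z = 2%:R ^+ n,
        V 1%N (2 * n)%N%:Z = n%:R * 'C(2 * n, n)%:R
      & V 1%N (2 * n + 1)%N%:Z = (2 * n + 1)%N%:R * 'C(2 * n, n)%:R].

(* Main.v *)
(** Since 4 (n/2 - k)^2 = n^2 - 4 k (n - k) and
    k (n - k) C(n, k) = n (n - 1) C(n - 2, k - 1), while
    n/2 - k = (n - 2)/2 - (k - 1), the recurrence holds summand by summand.
    For r = 1 the signed sums telescope:
    the sum of (m - 2k) C(m, k) over k < j is j C(m, j). *)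
Require Import Defs.
From mathcomp Require Import ring lra zify.

Import GRing.Theory Num.Theory.
Local Open Scope ring_scope.

Lemma U_natE (r m : nat) :
  U r m = \sum_(0 <= k < m.+1) 'C(m, k)%:R * `|m%:R / 2%:R - k%:R : rat| ^+ r.
Proof.
rewrite /U (@fsbigE _ _ _ _ _ [seq Posz k | k <- index_iota 0 m.+1]).
- by rewrite big_map; apply: eq_bigl => k; rewrite mem_set.
- by rewrite map_inj_uniq ?iota_uniq // => ? ? [].
- by [].
- case=> [k _|k _ _]; last by rewrite mul0r.
  rewrite mem_map ?mem_index_iota; last by move=> ? ? [].
  by rewrite /= -leqNgt => lt_mk; rewrite bin_small // mul0r.
Qed.

(** Two absorptions: [k.+1] turns C(m+2, k+1) into (m+2) C(m+1, k), then m+1-k turns C(m+1, k) into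
    (m+1) C(m, k). *)
Lemma bin_mul_sub (m k : nat) : (k <= m)%N ->
  k.+1%:R * (m.+1%:R - k%:R) * 'C(m.+2, k.+1)%:R =
    m.+2%:R * m.+1%:R * 'C(m, k)%:R :> rat.
Proof.
move=> le_km; rewrite -natrB; last by apply: leqW.
rewrite -!natrM; congr _%:R.
rewrite mulnAC -mul_bin_diag /= mulnAC -!mulnA; congr muln.
by rewrite (mul_bin_down m.+1 k).
Qed.

Lemma recurrence_U : recurrence U.
Proof.
(* For n = 0 and n = 1 the argument n - 2 is negative, so these cases are computed directly. *)
move=> r [|[|m]].
- by rewrite !U_natE !big_nat1 mul0r sub0r normrN normr0 !exprS; ring.
- rewrite !U_natE !big_nat_recr //= !big_nil !exprS.
  rewrite (_ : `|1 / 2%:R - 0| = 1 / 2%:R :> rat) //.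
  rewrite (_ : `|1 / 2%:R - 1| = 1 / 2%:R :> rat) //.
  by field.
have -> : m.+2%:Z - 2%:Z = m%:Z by lia.
rewrite !U_natE.
have split_term k :
    4%:R * ('C(m.+2, k)%:R * `|m.+2%:R / 2%:R - k%:R : rat| ^+ r.+2) =
    m.+2%:R ^+ 2 * ('C(m.+2, k)%:R * `|m.+2%:R / 2%:R - k%:R| ^+ r) -
    4%:R * (k%:R * (m.+2%:R - k%:R) * 'C(m.+2, k)%:R *
      `|m.+2%:R / 2%:R - k%:R| ^+ r).
  set x := _ - _; have -> : `|x| ^+ r.+2 = x ^+ 2 * `|x| ^+ r.
    by rewrite -(real_normK (num_real x)) -exprD.
  by rewrite /x; field.
rewrite mulr_sumr (eq_bigr _ (fun k _ => split_term k)).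
rewrite sumrB -!mulr_sumr; congr (_ - _).
rewrite -!mulrA; congr (_ * _).
(* The factor k (m+2-k) kills the two end terms; the remaining indices are shifted by one. *)
rewrite big_nat_recl // big_nat_recr //= !mul0r add0r subrr mulr0 !mul0r addr0.
rewrite mulrA mulr_sumr; apply: eq_big_nat => k /andP[_ lt_km].
have -> : m.+2%:R / 2%:R - k.+1%:R = m%:R / 2%:R - k%:R :> rat by field.
have -> : m.+2%:R - k.+1%:R = m.+1%:R - k%:R :> rat by ring.
have -> : m.+2%:R - 1 = m.+1%:R :> rat by ring.
by rewrite bin_mul_sub // mulrA.
Qed.

Lemma U0E (n : nat) : U 0 n = 2%:R ^+ n.
Proof.
rewrite U_natE -natrX -[in RHS](addn1 1) expnDn natr_sum big_mkord.
by apply: eq_bigr => k _; rewrite !exp1n !muln1 expr0 mulr1.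
Qed.

Lemma signed_bin_sum (m j : nat) :
  \sum_(0 <= k < j) 'C(m, k)%:R * (m%:R / 2%:R - k%:R) =
    j%:R * 'C(m, j)%:R / 2%:R :> rat.
Proof.
elim: j => [|j IHj]; first by rewrite big_nil !mul0r.
rewrite big_nat_recr //= {}IHj -[in RHS]natrM mul_bin_left natrM.
(* The difference m - j is truncated when m < j, but then C(m, j) = 0. *)
case: (leqP j m) => [le_jm | lt_mj]; first by rewrite natrB //; field.
by rewrite bin_small //; ring.
Qed.

(** The hypotheses make j the half of m rounded up, where m/2 - k changes sign. The full signed sum
    is 0, so the parts below and from j on are opposite, and [U 1 m] is twice the lower one. *)
Lemma U1E (m j : nat) : (j.*2 <= m.+1)%N -> (m <= j.*2)%N ->
  U 1 m = j%:R * 'C(m, j)%:R.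
Proof.
move=> le_jm le_mj; rewrite U_natE.
have le_j : (j <= m.+1)%N by lia.
have total : \sum_(0 <= k < m.+1) 'C(m, k)%:R * (m%:R / 2%:R - k%:R) = 0 :> rat.
  by rewrite signed_bin_sum bin_small // mulr0 mul0r.
move: total; rewrite (big_cat_nat (leq0n j) le_j) /= signed_bin_sum => /eqP.
rewrite addrC addr_eq0 => /eqP upper.
rewrite (big_cat_nat (leq0n j) le_j) /=.
rewrite (@eq_big_nat _ _ _ 0 j _
  (fun k => 'C(m, k)%:R * (m%:R / 2%:R - k%:R))); last first.
  move=> k /andP[_ lt_kj]; rewrite expr1 ger0_norm //.
  have : k%:R * 2%:R <= m%:R :> rat by rewrite -natrM ler_nat; lia.
  by lra.
rewrite (@eq_big_nat _ _ _ j m.+1 _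
  (fun k => - ('C(m, k)%:R * (m%:R / 2%:R - k%:R)))); last first.
  move=> k /andP[le_jk _]; rewrite expr1 -mulrN ler0_norm //.
  have : m%:R <= k%:R * 2%:R :> rat by rewrite -natrM ler_nat; lia.
  by lra.
by rewrite sumrN upper signed_bin_sum; field.
Qed.

Lemma initial_conditions_U : initial_conditions U.
Proof.
move=> n; split; first exact: U0E.
- by apply: U1E; lia.
(* Absorption: (n+1) C(2n+1, n+1) = (2n+1) C(2n, n). *)
- rewrite (@U1E _ n.+1); [|lia|lia].
  by rewrite -!natrM -mul_bin_diag addn1.
Qed.

Lemma recurrence_uniq (V W : nat -> int -> rat) :
  recurrence V -> initial_conditions V ->
  recurrence W -> initial_conditions W ->
  forall r n : nat, V r n = W r n.
Proof.
move=> recV initV recW initW r.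
(* The recurrence raises r by 2, so the induction carries two consecutive values of r. *)
suff [] : (forall n : nat, V r n = W r n) /\
          (forall n : nat, V r.+1 n = W r.+1 n) by [].
elim: r => [|r [IH0 IH1]].
  split=> n; first by have [-> _ _] := initV n; have [-> _ _] := initW n.
  have [_ Ve Vo] := initV n./2; have [_ We Wo] := initW n./2.
  rewrite -(odd_double_half n) -mul2n addnC.
  by case: (odd n); rewrite ?addn0 ?Vo ?Wo ?Ve ?We.
split=> // n.
have nz4 : 4%:R != 0 :> rat by [].
apply: (mulfI nz4); rewrite recV recW IH0; congr (_ - _).
(* For n = 0, 1 the coefficient n (n-1) cancels the values at negative arguments, where V and W may
   differ. *)
case: n => [|[|n]]; [by rewrite !mulr0 !mul0r | by rewrite subrr !mulr0 !mul0r |].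
have -> : n.+2%:Z - 2%:Z = n%:Z by lia.
by rewrite IH0.
Qed.

(* "U may be computed from the recurrence and the initial conditions" is the
   last conjunct: these data determine the values at all r, n in N. *)
Theorem theorem1 :
  recurrence U /\ initial_conditions U /\
  (forall V : nat -> int -> rat,
     recurrence V -> initial_conditions V ->
     forall r n : nat, V r (Posz n) = U r (Posz n)).
Proof.
split; first exact: recurrence_U.
split; first exact: initial_conditions_U.
move=> V recV initV; apply: recurrence_uniq => //.
- exact: recurrence_U.
- exact: initial_conditions_U.
Qed.
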